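(* Let $S$ be an intra-regular AG-groupoid. The set of all intuitionistic fuzzy two-sided ideals of $S$, with the product $\circ$, forms a semilattice (i.e. $\circ$ is a binary operation on this set which is associative, commutative and idempotent) with identity element $\delta=(S_\delta,\Theta_\delta)$.
   Context: An AG-groupoid is a non-empty set $S$ with a binary operation (written by juxtaposition) satisfying $(ab)c=(cb)a$ for all $a,b,c\in S$. $S$ is intra-regular if for every $a\in S$ there exist $x,y\in S$ with $a=(xa^2)y$, where $a^2=aa$. An intuitionistic fuzzy set (IFS) $A=(\mu_A,\gamma_A)$ of $S$ is a pair of functions $\mu_A,\gamma_A:S\to[0,1]$ with $0\le\mu_A(x)+\gamma_A(x)\le1$ for all $x\in S$. Write $\wedge=\min$, $\vee=\max$. The product $A\circ B=(\mu_A\circ\mu_B,\gamma_A\circ\gamma_B)$ is given by $(\mu_A\circ\mu_B)(a)=\bigvee_{a=bc}\{\mu_A(b)\wedge\mu_B(c)\}$ (supremum over all $b,c\in S$ with $a=bc$) if $a=bc$ for some $b,c\in S$, and $0$ otherwise; $(\gamma_A\circ\gamma_B)(a)=\bigwedge_{a=bc}\{\gamma_A(b)\vee\gamma_B(c)\}$ (infimum) if $a=bc$ for some $b,c\in S$, and $1$ otherwise. $\delta=(S_\delta,\Theta_\delta)$ is the IFS with $S_\delta(x)=1$ and $\Theta_\delta(x)=0$ for all $x\in S$. An IFS $A$ of $S$ is an intuitionistic fuzzy two-sided ideal if $\mu_A(xy)\ge\mu_A(y)$, $\gamma_A(xy)\le\gamma_A(y)$, $\mu_A(xy)\ge\mu_A(x)$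 and $\gamma_A(xy)\le\gamma_A(x)$ for all $x,y\in S$. *)

(* Defs.v *)
From mathcomp Require Import all_boot all_order all_algebra.
From mathcomp Require Import boolp classical_sets reals.
Set Implicit Arguments.
Unset Strict Implicit.
Unset Printing Implicit Defensive.
Import Order.TTheory GRing.Theory Num.Theory.

Local Open Scope ring_scope.
Local Open Scope classical_set_scope.

(* [mul] is the juxtaposition of the groupoid; it is not assumed associative. *)
Definition ag_groupoid (S : Type) (mul : S -> S -> S) : Prop :=
  inhabited S /\ forall a b c : S, mul (mul a b) c = mul (mul c b) a.

Definition intra_regular (S : Type) (mul : S -> S -> S) : Prop :=
  forall a : S, exists x y : S, a = mul (mul x (mul a a)) y.

Record ifs (R : realType) (S : Type) := IFS {
  ifs_mu : S -> R;
  ifs_gamma : S -> R;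
  ifs_mu01 : forall x, 0 <= ifs_mu x <= 1;
  ifs_gamma01 : forall x, 0 <= ifs_gamma x <= 1;
  ifs_sum01 : forall x, 0 <= ifs_mu x + ifs_gamma x <= 1 }.

Lemma ifs_eqP (R : realType) (S : Type) (A B : ifs R S) :
  ifs_mu A =1 ifs_mu B -> ifs_gamma A =1 ifs_gamma B -> A = B.
Proof.
case: A => m g a b c; case: B => m' g' a' b' c' /= /funext em /funext eg.
by subst m' g'; congr IFS; apply: Prop_irrelevance.
Qed.

Section Product.
Variables (R : realType) (S : Type) (mul : S -> S -> S).

Definition decomposable (a : S) : Prop := exists b c : S, a = mul b c.

Definition sup_prod (f g : S -> R) (a : S) : R :=
  if `[< decomposable a >]
  then sup [set r | exists b c : S, a = mul b c /\ r = Num.min (f b) (g c)]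
  else 0.

Definition inf_prod (f g : S -> R) (a : S) : R :=
  if `[< decomposable a >]
  then inf [set r | exists b c : S, a = mul b c /\ r = Num.max (f b) (g c)]
  else 1.

Lemma sup_prod_bounds (f g : S -> R) :
  (forall x, 0 <= f x <= 1) -> (forall x, 0 <= g x <= 1) ->
  forall a, 0 <= sup_prod f g a <= 1.
Proof.
move=> hf hg a; rewrite /sup_prod; case: asboolP => [[b [c abc]]|_]; last first.
  by rewrite lexx ler01.
set E := [set r | _].
have E01 r : E r -> 0 <= r <= 1.
  move=> [b' [c' [_ ->]]].
  have /andP[f0 f1] := hf b'; have /andP[g0 g1] := hg c'.
  by rewrite le_min f0 g0 ge_min f1.
have Ebc : E (Num.min (f b) (g c)) by exists b, c.
have ubE : ubound E 1 by move=> r /E01/andP[].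
apply/andP; split; last by apply: ge_sup => //; exists (Num.min (f b) (g c)).
have /andP[h0 _] := E01 _ Ebc; apply: (le_trans h0).
by apply: ub_le_sup => //; exists 1.
Qed.

Lemma inf_prod_bounds (f g : S -> R) :
  (forall x, 0 <= f x <= 1) -> (forall x, 0 <= g x <= 1) ->
  forall a, 0 <= inf_prod f g a <= 1.
Proof.
move=> hf hg a; rewrite /inf_prod; case: asboolP => [[b [c abc]]|_]; last first.
  by rewrite lexx ler01.
set E := [set r | _].
have E01 r : E r -> 0 <= r <= 1.
  move=> [b' [c' [_ ->]]].
  have /andP[f0 f1] := hf b'; have /andP[g0 g1] := hg c'.
  by rewrite le_max f0 ge_max f1 g1.
have Ebc : E (Num.max (f b) (g c)) by exists b, c.
have lbE : lbound E 0 by move=> r /E01/andP[].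
apply/andP; split; first by apply: lb_le_inf => //; exists (Num.max (f b) (g c)).
have /andP[_ h1] := E01 _ Ebc; apply: le_trans h1.
by apply: ge_inf => //; exists 0.
Qed.

Lemma ifs_prod_sum01 (A B : ifs R S) (a : S) :
  0 <= sup_prod (ifs_mu A) (ifs_mu B) a
       + inf_prod (ifs_gamma A) (ifs_gamma B) a <= 1.
Proof.
have /andP[s0 _] := sup_prod_bounds (ifs_mu01 A) (ifs_mu01 B) a.
have /andP[i0 _] := inf_prod_bounds (ifs_gamma01 A) (ifs_gamma01 B) a.
rewrite addr_ge0 //= -lerBrDr {s0 i0}.
rewrite /sup_prod /inf_prod; case: asboolP => [[b [c abc]]|_]; last by rewrite subrr.
apply: ge_sup; first by exists (Num.min (ifs_mu A b) (ifs_mu B c)), b, c.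
move=> _ [b' [c' [abc' ->]]]; rewrite lerBrDr -lerBrDl.
have le_inf : inf [set r | exists b c, a = mul b c /\
    r = Num.max (ifs_gamma A b) (ifs_gamma B c)]
    <= Num.max (ifs_gamma A b') (ifs_gamma B c').
  apply: ge_inf; last by exists b', c'.
  exists 0 => _ [b1 [c1 [_ ->]]].
  by have /andP[h _] := ifs_gamma01 A b1; rewrite le_max h.
apply: le_trans le_inf _; rewrite lerBrDl.
have /andP[_ hA] := ifs_sum01 A b'; have /andP[_ hB] := ifs_sum01 B c'.
rewrite -lerBrDl ge_max !lerBrDl; apply/andP; split.
  by apply: le_trans hA; rewrite lerD2r ge_min lexx.
by apply: le_trans hB; rewrite lerD2r ge_min lexx orbT.
Qed.

Definition ifs_prod (A B : ifs R S) : ifs R S :=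
  IFS (sup_prod_bounds (ifs_mu01 A) (ifs_mu01 B))
      (inf_prod_bounds (ifs_gamma01 A) (ifs_gamma01 B))
      (ifs_prod_sum01 A B).

Definition if_two_sided_ideal (A : ifs R S) : Prop :=
  forall x y : S,
    [/\ ifs_mu A y <= ifs_mu A (mul x y),
        ifs_gamma A (mul x y) <= ifs_gamma A y,
        ifs_mu A x <= ifs_mu A (mul x y) &
        ifs_gamma A (mul x y) <= ifs_gamma A x].

End Product.

Section Delta.
Variables (R : realType) (S : Type).

Lemma delta_mu01 (x : S) : 0 <= (1 : R) <= 1.
Proof. by rewrite ler01 lexx. Qed.

Lemma delta_gamma01 (x : S) : 0 <= (0 : R) <= 1.
Proof. by rewrite ler01 lexx. Qed.

Lemma delta_sum01 (x : S) : 0 <= (1 + 0 : R) <= 1.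
Proof. by rewrite addr0 ler01 lexx. Qed.

Definition ifs_delta : ifs R S :=
  @IFS R S (fun=> 1) (fun=> 0) delta_mu01 delta_gamma01 delta_sum01.

End Delta.

(* The operation is given on an ambient type [T]; closure of the carrier [X]
   is what makes it a binary operation on [X]. *)
Definition semilattice_on (T : Type) (X : set T) (op : T -> T -> T) : Prop :=
  [/\ forall x y, X x -> X y -> X (op x y),
      forall x y z, X x -> X y -> X z -> op x (op y z) = op (op x y) z,
      forall x y, X x -> X y -> op x y = op y x &
      forall x, X x -> op x x = x].

Definition identity_on (T : Type) (X : set T) (op : T -> T -> T) (e : T) : Prop :=
  X e /\ forall x, X x -> op e x = x /\ op x e = x.

(* Main.v *)
Require Import Defs.
From mathcomp Require Import all_boot all_order all_algebra.
From mathcomp Require Import boolp classical_sets reals.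
Import Order.TTheory GRing.Theory Num.Theory.
Local Open Scope ring_scope.
Local Open Scope classical_set_scope.

(** On two-sided ideals of an intra-regular AG-groupoid the product is the
    pointwise meet: [mu] is the minimum of the two [mu]'s and [gamma] the maximum
    of the two [gamma]'s ([ifs_prod_mu], [ifs_prod_gamma]).  The semilattice laws
    are then those of [Num.min] and [Num.max], and [ifs_delta] is neutral
    because its components 1 and 0 are the extreme values.

    That the product lies below the meet only uses the ideal inequalities.
    Conversely, the supremum and infimum defining the product are attained,
    because every [a] is a product of two factors, each obtained from [a] by left
    multiplications ([intra_regular_factor]): along these the ideal inequalities
    make [mu] grow and [gamma] decrease, so that this one factorization already
    reaches the minimum of the two [mu]'s and the maximum of the two [gamma]'s
    at [a]. *)

Lemma ag_medial (S : Type) (mul : S -> S -> S) (hS : ag_groupoid mul)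
    (a b c d : S) :
  mul (mul a b) (mul c d) = mul (mul a c) (mul b d).
Proof.
have ag := hS.2.
by rewrite ag (ag c d b) ag.
Qed.

(** Split the left multiplier as [x = v * w] (intra-regularity provides such a
    splitting).  The medial law distributes the two copies of [a] over it, giving
    [x * a^2 = (v * a) * (w * a)], and the AG law turns [a = (x * a^2) * y] into
    [(y * (w * a)) * (v * a)]. *)
Lemma intra_regular_factor (S : Type) (mul : S -> S -> S)
    (hS : ag_groupoid mul) (hreg : intra_regular mul) (a : S) :
  exists u v w : S, a = mul (mul u (mul w a)) (mul v a).
Proof.
have [x [y aE]] := hreg a; have [z [w xE]] := hreg x.
exists y, (mul z (mul x x)), w.
by rewrite {1}aE {1}xE ag_medial // hS.2.
Qed.

Section PointwiseProduct.
Variables (R : realType) (S : Type) (mul : S -> S -> S).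
Hypotheses (hS : ag_groupoid mul) (hreg : intra_regular mul).

(** The supremum is a maximum, reached at the factorization of [a] given by
    [intra_regular_factor]. *)
Lemma sup_prod_min (f g : S -> R) :
  (forall x y, f y <= f (mul x y)) -> (forall x y, f x <= f (mul x y)) ->
  (forall x y, g y <= g (mul x y)) ->
  forall a, sup_prod mul f g a = Num.min (f a) (g a).
Proof.
move=> fl fr gl a; have [u [v [w aE]]] := intra_regular_factor _ _ hS hreg a.
rewrite /sup_prod; case: asboolP => [_|[]]; last by do 2!eexists; exact: aE.
set E := [set r | _].
have ubE : ubound E (Num.min (f a) (g a)).
  by move=> _ [b [c [-> ->]]]; rewrite le_min !ge_min fr gl orbT.
have Ea : E (Num.min (f (mul u (mul w a))) (g (mul v a))) by exists (mul u (mul w a)), (mul v a).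
apply/le_anti/andP; split; first by apply: ge_sup => //; eexists; exact: Ea.
apply: le_trans (ub_le_sup _ Ea); last by exists (Num.min (f a) (g a)).
rewrite le_min !ge_min gl orbT andbT.
by rewrite (le_trans (fl w a) (fl u _)).
Qed.

Lemma inf_prod_max (f g : S -> R) :
  (forall x y, f (mul x y) <= f y) -> (forall x y, f (mul x y) <= f x) ->
  (forall x y, g (mul x y) <= g y) ->
  forall a, inf_prod mul f g a = Num.max (f a) (g a).
Proof.
move=> fl fr gl a; have [u [v [w aE]]] := intra_regular_factor _ _ hS hreg a.
rewrite /inf_prod; case: asboolP => [_|[]]; last by do 2!eexists; exact: aE.
set E := [set r | _].
have lbE : lbound E (Num.max (f a) (g a)).
  by move=> _ [b [c [-> ->]]]; rewrite ge_max !le_max fr gl orbT.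
have Ea : E (Num.max (f (mul u (mul w a))) (g (mul v a))) by exists (mul u (mul w a)), (mul v a).
apply/le_anti/andP; split; last by apply: lb_le_inf => //; eexists; exact: Ea.
apply: (le_trans (ge_inf _ Ea)); first by exists (Num.max (f a) (g a)).
rewrite ge_max !le_max gl orbT andbT.
by rewrite (le_trans (fl u _) (fl w a)).
Qed.

Lemma ifs_prod_mu (A B : ifs R S) :
  if_two_sided_ideal mul A -> if_two_sided_ideal mul B ->
  forall a, ifs_mu (ifs_prod mul A B) a = Num.min (ifs_mu A a) (ifs_mu B a).
Proof.
by move=> hA hB; apply: sup_prod_min => x y;
  [case: (hA x y) | case: (hA x y) | case: (hB x y)].
Qed.

Lemma ifs_prod_gamma (A B : ifs R S) :
  if_two_sided_ideal mul A -> if_two_sided_ideal mul B ->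
  forall a,
    ifs_gamma (ifs_prod mul A B) a = Num.max (ifs_gamma A a) (ifs_gamma B a).
Proof.
by move=> hA hB; apply: inf_prod_max => x y;
  [case: (hA x y) | case: (hA x y) | case: (hB x y)].
Qed.

Lemma ifs_prod_ideal (A B : ifs R S) :
  if_two_sided_ideal mul A -> if_two_sided_ideal mul B ->
  if_two_sided_ideal mul (ifs_prod mul A B).
Proof.
move=> hA hB x y; rewrite !ifs_prod_mu // !ifs_prod_gamma //.
have [A1 A2 A3 A4] := hA x y; have [B1 B2 B3 B4] := hB x y.
by split; rewrite ?le_min2 ?le_max2.
Qed.

Lemma ifs_delta_ideal : if_two_sided_ideal mul (ifs_delta R S).
Proof. by move=> x y; split; rewrite /= lexx. Qed.

End PointwiseProduct.

Theorem theorem9 (R : realType) (S : Type) (mul : S -> S -> S)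
    (hS : ag_groupoid mul) (hreg : intra_regular mul) :
  semilattice_on [set A : ifs R S | if_two_sided_ideal mul A] (ifs_prod mul) /\
  identity_on [set A : ifs R S | if_two_sided_ideal mul A] (ifs_prod mul)
    (ifs_delta R S).
Proof.
have muE := ifs_prod_mu R S mul hS hreg.
have gaE := ifs_prod_gamma R S mul hS hreg.
have idl := ifs_prod_ideal R S mul hS hreg.
have idd := ifs_delta_ideal R S mul.
have comm (A B : ifs R S) : if_two_sided_ideal mul A ->
    if_two_sided_ideal mul B -> ifs_prod mul A B = ifs_prod mul B A.
  move=> hA hB; apply: ifs_eqP => a.
    by rewrite !muE // minC.
  by rewrite !gaE // maxC.
have idr (A : ifs R S) :
    if_two_sided_ideal mul A -> ifs_prod mul A (ifs_delta R S) = A.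
  move=> hA; apply: ifs_eqP => a.
    by rewrite muE //; apply: min_l; case/andP: (ifs_mu01 A a).
  by rewrite gaE //; apply: max_l; case/andP: (ifs_gamma01 A a).
split; last first.
  by split=> // A hA; split; [rewrite comm // idr | exact: idr].
split=> //.
- move=> A B C hA hB hC; have hAB := idl _ _ hA hB; have hBC := idl _ _ hB hC.
  apply: ifs_eqP => a; first by rewrite !muE // minA.
  by rewrite !gaE // maxA.
- move=> A hA; apply: ifs_eqP => a; first by rewrite muE // minxx.
  by rewrite gaE // maxxx.
Qed.
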